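(* Let $H$ be a real vector space of finite dimension $r$, and let $W\subset H\otimes\mathbb R^2=H\oplus H$ be a linear subspace containing no nonzero decomposable tensor $h\otimes u$ ($h\in H$, $u\in\mathbb R^2$). Then both coordinate projections $\pi_1,\pi_2:W\to H$ are injective, and for $U=\pi_1(W)$ there is a linear map $T:U\to H$ such that $$W=\{(u,Tu):u\in U\},\qquad Tu\notin\mathbb R u\quad\text{for all }0\ne u\in U .$$ Moreover $\dim W\le 2\lfloor r/2\rfloor$, and this bound is sharp for every $r$ (for every $r$-dimensional real $H$ there is a subspace $W\subset H\otimes\mathbb R^2$ without nonzero decomposable tensors and with $\dim W=2\lfloor r/2\rfloor$).
   Context: Under the identification $H\otimes\mathbb R^2=H\oplus H$, the tensor $h\otimes u$ with $u=(u_1,u_2)$ corresponds to $(u_1h,u_2h)$; $\pi_1,\pi_2$ are the projections onto the first and second summands. *)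

(* Defs.v *)
From HB Require Import structures.
From mathcomp Require Import all_boot all_order all_algebra.
From mathcomp Require Import reals.

Set Implicit Arguments.
Unset Strict Implicit.
Unset Printing Implicit Defensive.

Import GRing.Theory.
Local Open Scope ring_scope.

Section Tensors.
Variables (R : realType) (H : vectType R).

(* H ⊗ R^2 is identified with H ⊕ H, i.e. with the vector space H * H. *)
Definition tensor (h : H) (u : 'rV[R]_2) : H * H :=
  (u 0 0 *: h, u 0 1 *: h).

Definition no_nonzero_decomposable (W : {vspace (H * H)}) : Prop :=
  forall (h : H) (u : 'rV[R]_2),
    tensor h u \in W -> tensor h u = 0.

Definition pi1 : 'Hom((H * H)%type, H) := linfun fst.
Definition pi2 : 'Hom((H * H)%type, H) := linfun snd.

(* linfun is only meaningful on linear functions, which fst and snd are. *)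
Lemma pi1E (w : H * H) : pi1 w = w.1.
Proof. by rewrite lfunE. Qed.

Lemma pi2E (w : H * H) : pi2 w = w.2.
Proof. by rewrite lfunE. Qed.

End Tensors.

(* Main.v *)
Require Import Defs.
From HB Require Import structures.
From mathcomp Require Import all_boot all_order all_algebra.
From mathcomp Require Import reals.
From mathcomp Require polyrcf.

Set Implicit Arguments.
Unset Strict Implicit.
Unset Printing Implicit Defensive.

Import GRing.Theory VectorInternalTheory.
Local Open Scope ring_scope.

(** A subspace [W] without nonzero decomposable tensors meets the tensors
    [h ⊗ e_i] trivially, so it is the graph of a linear [T : U -> H], and [T]
    has no eigenvector in [U].  Hence [dim W = dim U <= r], and equality is
    impossible for odd [r], since an endomorphism of an odd-dimensional real
    space has a real eigenvalue.  The bound is attained by the graph of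
    [(a, b) |-> (- b, a)] on a copy of [R^m * R^m] in [H], [m = r / 2]: its
    square is [-1], so it has no real eigenvalue. *)

(** The characteristic polynomial has odd degree, hence a root in a real closed field. *)
Lemma odd_dim_eigenvector (R : rcfType) (V : vectType R) (f : {linear V -> V}) :
  odd (\dim {:V}) -> exists a : R, exists2 v : V, v != 0 & f v = a *: v.
Proof.
rewrite dimvf => oddV; pose A := lin1_mx (v2r \o f \o r2v).
have [a] : {a | root (char_poly A) a}.
  by apply: polyrcf.odd_poly_root; rewrite size_char_poly /= oddV.
rewrite -eigenvalue_root_char => /eigenvalueP [x xA x_neq0].
exists a, (r2v x).
  by apply: contra x_neq0 => /eqP x0; rewrite -[x]r2vK x0 linear0.
by apply: (can_inj v2rK); rewrite linearZ /= r2vK -xA mul_rV_lin1.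
Qed.

Section Graph.
Variables (R : realType) (H : vectType R) (W : {vspace (H * H)}).
Hypothesis Wdec : no_nonzero_decomposable W.

Let row2 (a b : R) : 'rV[R]_2 := \row_j (if j == 0 then a else b).

(** Used with [(a, b)] equal to [(0, 1)] and [(1, 0)] for injectivity, and to [(1, k)] to exclude
    eigenvectors of [T]. *)
Lemma no_decomposable_pair (a b : R) (h : H) :
  (a *: h, b *: h) \in W -> (a *: h, b *: h) = 0.
Proof.
have -> : (a *: h, b *: h) = tensor h (row2 a b) by rewrite /tensor !mxE.
exact: Wdec.
Qed.

Lemma pi1_inj : {in W &, injective (@pi1 R H)}.
Proof.
move=> [x y] [x' y'] Ww Ww'; rewrite !pi1E /= => exx'; rewrite -exx' in Ww' *.
(* The difference of the two elements of [W] is [(y - y') ⊗ e_2]. *)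
have /no_decomposable_pair : (0 *: (y - y'), 1 *: (y - y')) \in W.
  by have := rpredB Ww Ww'; rewrite scale0r scale1r -[_ - _]/(x - x, y - y') subrr.
by case=> _; rewrite scale1r => /eqP; rewrite subr_eq0 => /eqP ->.
Qed.

Lemma pi2_inj : {in W &, injective (@pi2 R H)}.
Proof.
move=> [x y] [x' y'] Ww Ww'; rewrite !pi2E /= => eyy'; rewrite -eyy' in Ww' *.
have /no_decomposable_pair : (1 *: (x - x'), 0 *: (x - x')) \in W.
  by have := rpredB Ww Ww'; rewrite scale0r scale1r -[_ - _]/(x - x', y - y) subrr.
by case=> + _; rewrite scale1r => /eqP; rewrite subr_eq0 => /eqP ->.
Qed.

Lemma dim_pi1_image : \dim (@pi1 R H @: W) = \dim W.
Proof.
apply: limg_dim_eq; apply/eqP; rewrite -subv0; apply/subvP => w.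
rewrite memv_cap memv_ker memv0 => /andP [Ww /eqP w0].
by apply/eqP; apply: pi1_inj; rewrite ?mem0v // w0 linear0.
Qed.

Lemma graph_of_no_decomposable :
  let U := (@pi1 R H @: W)%VS in
  exists T : {linear subvs_of U -> H},
    (forall w : H * H,
       w \in W <-> exists u : subvs_of U, w = (vsval u, T u)) /\
    (forall u : subvs_of U, u != 0 -> T u \notin <[vsval u]>%VS).
Proof.
(* [p] is [pi1] restricted to [W]; its pseudo-inverse is a right inverse on the image [U], so [T] is
   [pi2] after the inverse of [p]. *)
move=> U; pose p := linfun (@pi1 R H \o vsval : subvs_of W -> H).
have pE w : p w = (vsval w).1 by rewrite lfunE /= pi1E.
have UW (w : H * H) : w \in W -> w.1 \in U.
  by move=> Ww; rewrite -pi1E memv_img.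
have pVK u : u \in U -> p (p^-1%VF u) = u.
  move=> /memv_imgP [w Ww ->]; apply: limg_lfunVK.
  by apply/memv_imgP; exists (Subvs Ww); rewrite ?memvf // pE pi1E.
pose T : {linear subvs_of U -> H} := (@pi2 R H \o vsval \o p^-1%VF \o vsval).
have TW u : (vsval u, T u) \in W.
  have -> : (vsval u, T u) = vsval (p^-1%VF (vsval u)).
    by rewrite [RHS]surjective_pairing -pE pVK ?subvsP //= pi2E.
  exact: subvsP.
exists T; split=> [w|u].
  split=> [Ww|[u ->] //]; exists (Subvs (UW w Ww)).
  (* Both [w] and [(w.1, T w.1)] lie in [W] and share their first component. *)
  by apply: pi1_inj => //; rewrite !pi1E.
apply: contra => /vlineP [k Tu]; have := TW u.
rewrite Tu -{1}[vsval u]scale1r => /no_decomposable_pair [+ _].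
by rewrite scale1r => u0; apply/eqP/val_inj.
Qed.

Lemma dim_no_decomposable : (\dim W <= 2 * (\dim {:H} %/ 2))%N.
Proof.
have le_dim : (\dim W <= \dim {:H})%N by rewrite -dim_pi1_image dimvS ?subvf.
rewrite divn2 mul2n.
case oddH: (odd (\dim {:H})); last by rewrite even_halfK ?oddH.
(* For odd dimension the bound is [\dim {:H} - 1], so only equality of dimensions remains to be
   refuted. *)
rewrite odd_halfK // -ltnS prednK ?odd_gt0 // ltn_neqAle le_dim andbT.
apply/negP => /eqP dimW; have [T [_ Tnot]] := graph_of_no_decomposable.
have Ufull : (@pi1 R H @: W)%VS = fullv.
  by apply/eqP; rewrite eqEdim subvf dim_pi1_image dimW /=.
(* Since [U] is all of [H], [vsproj] inverts [vsval], and [T] becomes an endomorphism of [H]. *)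
have [a [v v_neq0 Tv]] :=
  odd_dim_eigenvector (T \o vsproj (@pi1 R H @: W)%VS) oddH.
have vK : vsval (vsproj (@pi1 R H @: W)%VS v) = v.
  by rewrite vsprojK // Ufull memvf.
have /Tnot /negP[] : vsproj (@pi1 R H @: W)%VS v != 0.
  by apply: contra v_neq0 => /eqP v0; rewrite -vK v0 linear0.
by rewrite -[T _]/((T \o vsproj _) v) Tv vK memvZ ?memv_line.
Qed.

End Graph.

(** Coordinates are padded with zeros; truncating them is a left inverse. *)
Lemma linear_injection_of_dim (R : fieldType) (V H : vectType R) :
  (\dim {:V} <= \dim {:H})%N -> exists f : {linear V -> H}, injective f.
Proof.
rewrite !dimvf => leVH.
exists (r2v \o mulmxr (pid_mx (dim V)) \o v2r : {linear V -> H}).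
apply: (can_inj (g := r2v \o mulmxr (pid_mx (dim V)) \o v2r)) => v /=.
by rewrite r2vK -mulmxA pid_mx_id // pid_mx_1 mulmx1 v2rK.
Qed.

Lemma exists_no_decomposable (R : realType) (H : vectType R) (m : nat) :
  (m + m <= \dim {:H})%N ->
  exists W : {vspace (H * H)},
    no_nonzero_decomposable W /\ \dim W = (m + m)%N.
Proof.
pose V : vectType R := ('rV[R]_m * 'rV[R]_m)%type.
have dimV : \dim {:V} = (m + m)%N by rewrite dimvf -[LHS]/(1 * m + 1 * m)%N !mul1n.
rewrite -{1}dimV => /linear_injection_of_dim [f f_inj].
pose J (v : V) : V := (- v.2, v.1).
have J_lin : linear J.
  by move=> a u v; congr pair; rewrite /= opprD scalerN.
pose g (v : V) : H * H := (f v, f (J v)).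
have g_lin : linear g.
  by move=> a u v; rewrite /g J_lin !linearP.
pose gM := GRing.isLinear.Build _ _ _ _ g g_lin.
pose gL : {linear V -> (H * H)%type} := HB.pack g gM.
exists (limg (linfun gL)); split=> [h u|]; last first.
  rewrite limg_dim_eq ?dimV //; apply/eqP; rewrite -subv0.
  apply/subvP => v; rewrite memv_cap memvf memv_ker lfunE memv0 /= => /eqP.
  by case=> fv0 _; apply/eqP/f_inj; rewrite fv0 linear0.
move=> /memv_imgP [v _]; rewrite lfunE /= /g /tensor.
set a := u 0 0; set b := u 0 1; move=> [ah bh].
(* Under [f] both sides become [(a * b) *: h]; no division by [a] or [b] is needed. *)
have : b *: v = a *: J v.
  by apply: f_inj; rewrite !linearZ /= -ah -bh !scalerA mulrC.
case: v ah bh => x y ah bh [/= bx ay].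
(* As [J] squares to [-1], the relation yields [(a * a + b * b) *: v = 0], checked below on each
   component. A zero sum of squares forces [a = b = 0], and the tensor vanishes. *)
have [ab0|ab_neq0] := eqVneq (a * a + b * b) 0.
  move/eqP: ab0; rewrite Num.Theory.paddr_eq0 -?expr2 ?Num.Theory.sqr_ge0 //.
  by rewrite !sqrf_eq0 => /andP [/eqP-> /eqP->]; rewrite scale0r.
have kill z : (a * a + b * b) *: z = 0 -> z = 0 :> 'rV[R]_m.
  by move=> /eqP; rewrite scaler_eq0 (negPf ab_neq0) => /eqP.
have x0 : x = 0.
  apply: kill; rewrite scalerDl -!scalerA bx -ay !scalerN !scalerA mulrC.
  exact: subrr.
have y0 : y = 0.
  apply: kill; rewrite scalerDl -!scalerA ay -[a *: y]opprK -scalerN -bx x0.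
  by rewrite !(scaler0, oppr0) addr0.
by rewrite ah bh /J x0 y0 oppr0 linear0.
Qed.

Theorem theorem6p6 (R : realType) (r : nat) (H : vectType R)
    (dimH : \dim {:H} = r) :
  (forall W : {vspace (H * H)}, no_nonzero_decomposable W ->
     [/\ {in W &, injective (@pi1 R H)},
         {in W &, injective (@pi2 R H)},
         (let U := (@pi1 R H @: W)%VS in
          exists T : {linear subvs_of U -> H},
            (forall w : H * H,
               w \in W <-> exists u : subvs_of U, w = (vsval u, T u)) /\
            (forall u : subvs_of U, u != 0 -> T u \notin <[vsval u]>%VS))
       & (\dim W <= 2 * (r %/ 2))%N]) /\
  (exists W : {vspace (H * H)},
     no_nonzero_decomposable W /\ \dim W = (2 * (r %/ 2))%N).
Proof.
rewrite -dimH; split=> [W Wdec|].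
  split; [exact: pi1_inj | exact: pi2_inj | exact: graph_of_no_decomposable |].
  exact: dim_no_decomposable.
rewrite mul2n -addnn; apply: exists_no_decomposable.
by rewrite addnn -mul2n mulnC leq_trunc_div.
Qed.
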